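(* Let $X$ be a complete metric space and $w_1,\ldots,w_N$ be contracting homeomorphisms of the space $X$ onto $X$. If $\mathcal D=\mathcal D(w_1,\ldots,w_N)\neq\emptyset$, then: 1. $w_i(\mathcal D)\subset\mathcal D$, $i=1,\ldots,N$; 2. $w_i(\mathcal D)\cap w_j(\mathcal D)=\emptyset$, $i\neq j$; 3. $\overline{\mathcal D}=A$; 4. $(w_1,\ldots,w_N)\in\bigcap_{n=1}^{\infty}\mathcal V_n$.
   Context: $\mathbb N=\{1,2,\ldots\}$, $N\in\mathbb N$, and $d$ is the distance in $X$. A mapping $w:X\to X$ is contracting if $\sigma(w)=\sup_{x\neq y\in X}\frac{d(w(x),w(y))}{d(x,y)}<1$. $\mathcal M(X)$ denotes the set of all contracting homeomorphisms of $X$ onto itself. For $(w_1,\ldots,w_N)\in(\mathcal M(X))^N$, the attractor $A=A(w_1,\ldots,w_N)$ is the unique non-empty compact subset of $X$ with $A=\bigcup_{i=1}^N w_i(A)$. Let $\Sigma=\{1,\ldots,N\}$, $\mathcal F=\bigcup_{n\in\mathbb N}\Sigma^n$, and for $\mathbf i=(i_1,\ldots,i_n)\in\Sigma^n$ let $w_{\mathbf i}=w_{i_1}\circ\cdots\circ w_{i_n}$. Let $\mathcal T=\bigcup_{i\neq j}\bigl(w_i(A)\cap w_j(A)\bigr)$ and $\mathcal D(w_1,\ldots,w_N)=A\setminus\bigcup_{\mathbf i\in\mathcal F}w_{\mathbf i}^{-1}(\mathcal T)$. For $n\in\mathbb N$, $\mathcal V_n$ is the set of all ordered $N$-tuples $(w_1,\ldots,w_N)\in(\mathcal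 M(X))^N$ such that for every $\mathbf i\in\Sigma^n$, $w_{\mathbf i}(A)\nsubseteq\bigcup_{\mathbf j\in\Sigma^n,\ \mathbf j\neq\mathbf i}w_{\mathbf j}(A)$. *)

(* Defs.v *)
From HB Require Import structures.
From mathcomp Require Import all_boot all_order all_algebra.
From mathcomp Require Import all_classical all_reals all_analysis.

Set Implicit Arguments.
Unset Strict Implicit.
Unset Printing Implicit Defensive.

Import Order.TTheory GRing.Theory Num.Theory.

Local Open Scope classical_set_scope.
Local Open Scope ring_scope.

(* As everywhere in the library, completeness comes with a base point: X is
   non-empty, as it must be to contain a non-empty attractor. *)
#[short(type="completeMetricType")]
HB.structure Definition CompleteMetric (R : numDomainType) :=
  {X of Metric R X & Complete X}.

Definition homeomorphism {X Y : topologicalType} (f : X -> Y) : Prop :=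
  continuous f /\
  exists g : Y -> X, [/\ cancel f g, cancel g f & continuous g].

Section contractions.
Context {R : realType} {X : metricType R}.
Implicit Type f : X -> X.

(* The supremum is taken in \bar R: it is +oo for a map that is not Lipschitz,
   and -oo (so that the map is contracting) when X has no two distinct points. *)
Definition contraction_ratio f : \bar R :=
  ereal_sup [set (mdist (f p.1) (f p.2) / mdist p.1 p.2)%:E
            | p in [set p : X * X | p.1 != p.2]].

Definition contracting f : Prop := (contraction_ratio f < 1)%E.

Definition contracting_homeomorphisms : set (X -> X) :=
  [set f | contracting f /\ homeomorphism f].

End contractions.

Section iterated_function_system.
Context {R : realType} {X : metricType R} {N : nat}.
Implicit Type w : 'I_N -> X -> X.

Definition is_attractor w (A : set X) : Prop :=
  [/\ A !=set0, compact A & A = \bigcup_i w i @` A].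

(* For N >= 1 contractions of a complete X there is exactly one such set (Hutchinson);
   for systems that have none, the value is set0. *)
Definition attractor w : set X := [get A | is_attractor w A].

(* word_map w [:: i_1; ...; i_n] = w i_1 \o ... \o w i_n *)
Definition word_map w (s : seq 'I_N) : X -> X :=
  foldr (fun i f => w i \o f) id s.

Definition overlap w : set X :=
  \bigcup_(p in [set p : 'I_N * 'I_N | p.1 != p.2])
    (w p.1 @` attractor w `&` w p.2 @` attractor w).

Definition non_overlap w : set X :=
  attractor w `\`
  \bigcup_(s in [set s : seq 'I_N | s != [::]]) word_map w s @^-1` overlap w.

Definition irredundant (n : nat) : set ('I_N -> X -> X) :=
  [set w | (forall i, contracting_homeomorphisms (w i)) /\
    forall s : n.-tuple 'I_N,
      ~ (word_map w s @` attractor w `<=`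
         \bigcup_(t in [set t : n.-tuple 'I_N | t != s])
           word_map w t @` attractor w)].

End iterated_function_system.

Arguments irredundant {R} X N n.

(* Main.v *)
Require Import Defs.
From HB Require Import structures.
From mathcomp Require Import all_boot all_order all_algebra.
From mathcomp Require Import all_classical all_reals all_analysis.

Set Implicit Arguments.
Unset Strict Implicit.
Unset Printing Implicit Defensive.

Import Order.TTheory GRing.Theory Num.Theory numFieldNormedType.Exports.

Local Open Scope classical_set_scope.
Local Open Scope ring_scope.

(** Write [A] for the attractor and [D] for [non_overlap w]: a point [x] of [A]
    lies in [D] when no non-empty word [s] sends it into the overlap, that is,
    when [word_map w s x] never has two addresses in [A] that start with
    different letters.

    The words applied to [w i x] are words applied to [x] with one more letter,
    so [D] is stable under each [w i], hence under each [word_map w s]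
    ([word_map_non_overlap]).  A single point [x] of [D] therefore gives the
    whole orbit [word_map w s x] inside [D], and this orbit is dense in [A]: a
    point of [A] is [word_map w s b] with [s] as long as desired and [b] in
    [A] ([attractor_word_map]), and [word_map w s] shrinks the distance from
    [b] to [x], which is bounded because [A] is compact, by a geometric factor.

    The two disjointness claims both come from [word_map_separates]: if
    [word_map w s x] with [x] in [D] equals [word_map w t a] with [a] in [A] and
    [t] as long as [s], then [t] is [s].  Indeed, by injectivity the common
    prefix of [s] and [t] can be cancelled, and if letters remained, the
    two remaining words would start differently and put the image of [x] by a
    non-empty word in the overlap.  So
    [word_map w s x] witnesses that the piece of index [s] is not covered by the
    other pieces of the same level. *)

Lemma contracting_lipschitz (R : realType) (X : metricType R) (f : X -> X) :
  contracting f ->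
  exists2 q : R, 0 <= q < 1 &
    forall x y, mdist (f x) (f y) <= q * mdist x y.
Proof.
rewrite /contracting => f1.
have ratio_le x y : x != y ->
    ((mdist (f x) (f y) / mdist x y)%:E <= contraction_ratio f)%E.
  by move=> xy; apply: ereal_sup_ubound; exists (x, y).
(* The ratio is -oo when X is a single point, hence the maximum with 0. *)
exists (Num.max 0 (fine (contraction_ratio f))).
  rewrite le_max lexx /= gt_max ltr01 /=.
  by case: (contraction_ratio f) f1 => [r| |]; rewrite ?lte_fin //= ?ltr01.
move=> x y; have [->|xy] := eqVneq x y; first by rewrite !mdistxx mulr0.
rewrite -ler_pdivrMr ?mdist_gt0 // le_max; apply/orP; right.
by case: (contraction_ratio f) f1 (ratio_le _ _ xy) => [r| |]; rewrite ?lee_fin.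
Qed.

Lemma contracting_common_ratio (R : realType) (X : metricType R) (N : nat)
    (w : 'I_N -> X -> X) :
  (forall i, contracting (w i)) ->
  exists2 q : R, 0 <= q < 1 &
    forall i x y, mdist (w i x) (w i y) <= q * mdist x y.
Proof.
move=> wc; pose P i (q : R) :=
  0 <= q < 1 /\ forall x y, mdist (w i x) (w i y) <= q * mdist x y.
have /choice[q qP] : forall i, exists q, P i q.
  by move=> i; have [q q01 ql] := contracting_lipschitz (wc i); exists q.
exists (\big[Num.max/0]_i q i) => [|i x y].
  apply/andP; split; first exact: bigmax_ge_id.
  by apply: bigmax_lt => // i _; case: (qP i) => /andP[].
have [_ /(_ x y)/le_trans->//] := qP i.
by rewrite ler_wpM2r ?mdist_ge0 // le_bigmax.
Qed.

Lemma compact_mdist_bounded (R : realType) (X : metricType R) (A : set X)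
    (x : X) :
  compact A -> exists M : R, forall a, A a -> mdist x a <= M.
Proof.
move=> cA; have [A0|/set0P A0] := eqVneq A set0.
  by exists 0 => a; rewrite A0.
have dist_cont : continuous (mdist x : X -> R).
  move=> a; apply/cvgrPdist_lt => e e0.
  have : nbhs a (ball a e) by exact: nbhsx_ballx.
  apply: filterS => b; rewrite ballEmdist /= => ab.
  rewrite ltr_distl ltrBlDr; apply/andP; split.
    by rewrite (le_lt_trans (metric_triangle _ a _)) // ltrD2l.
  by rewrite (le_lt_trans (metric_triangle _ b _)) // ltrD2l metric_sym.
have [a _ aM] := compact_EVT_max A0 cA (continuous_subspaceT dist_cont).
by exists (mdist x a) => b Ab; apply: aM; rewrite inE.
Qed.

Section iterated_function_system.
Context (R : realType) (X : metricType R) (N : nat).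
Implicit Types (w : 'I_N -> X -> X) (s t : seq 'I_N).

(** The default value of the attractor is empty, so a system with a non-empty
    [attractor] has a genuine one. *)
Lemma attractor_is_attractor w :
  attractor w !=set0 -> is_attractor w (attractor w).
Proof.
move=> A0; apply: getPex; apply: contrapT => noA; case: A0 => x.
by rewrite /attractor getPN // => A Aw; apply: noA; exists A.
Qed.

Lemma word_map_rcons w s i x :
  word_map w (rcons s i) x = word_map w s (w i x).
Proof. by elim: s => //= j s ->. Qed.

Lemma word_map_lipschitz w q s x y : 0 <= q ->
  (forall i x y, mdist (w i x) (w i y) <= q * mdist x y) ->
  mdist (word_map w s x) (word_map w s y) <= q ^+ size s * mdist x y.
Proof.
move=> q0 wq; elim: s => [|i s IHs] /=; first by rewrite expr0 mul1r.
by rewrite (le_trans (wq _ _ _)) // exprS -mulrA ler_wpM2l.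
Qed.

Lemma map_attractor w i x :
  is_attractor w (attractor w) -> attractor w x -> attractor w (w i x).
Proof. by case=> _ _ AE Ax; rewrite AE; exists i => //; exists x. Qed.

Lemma word_map_mem_attractor w s x :
  is_attractor w (attractor w) -> attractor w x -> attractor w (word_map w s x).
Proof. by move=> wA Ax; elim: s => //= i s IHs; exact: map_attractor. Qed.

Lemma attractor_word_map w n a :
  is_attractor w (attractor w) -> attractor w a ->
  exists2 s, size s = n & exists2 b, attractor w b & a = word_map w s b.
Proof.
move=> [_ _ AE]; elim: n a => [|n IHn] a Aa; first by exists [::] => //; exists a.
move: Aa; rewrite {1}AE => -[i _ [b /IHn[s sn [c Ac ->]] <-]].
by exists (i :: s); rewrite /= ?sn //; exists c.
Qed.

Lemma non_overlap_attractor w : non_overlap w `<=` attractor w.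
Proof. by move=> x []. Qed.

Lemma map_non_overlap w i x : is_attractor w (attractor w) ->
  non_overlap w x -> non_overlap w (w i x).
Proof.
move=> wA [Ax Dx]; split; first exact: map_attractor.
move=> [s _ sx]; apply: Dx; exists (rcons s i); first by case: s {sx}.
by rewrite /= word_map_rcons.
Qed.

Lemma word_map_non_overlap w s x : is_attractor w (attractor w) ->
  non_overlap w x -> non_overlap w (word_map w s x).
Proof. by move=> wA Dx; elim: s => //= i s IHs; exact: map_non_overlap. Qed.

(** Cancelling the common prefix of [s] and [t] leaves words with different
    first letters, which would place an image of [x] in the overlap. *)
Lemma word_map_separates w s t x a : is_attractor w (attractor w) ->
  (forall i, injective (w i)) -> non_overlap w x -> attractor w a ->
  size s = size t -> word_map w s x = word_map w t a -> s = t.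
Proof.
move=> wA winj [Ax Dx] Aa; elim: s t => [|i s IHs] [|j t] //= [st] eq_st.
have [ij|ij] := eqVneq i j.
  by rewrite -ij in eq_st *; rewrite (IHs t) //; exact: winj eq_st.
exfalso; apply: Dx; exists (i :: s) => //; exists (i, j) => //=; split.
  by exists (word_map w s x) => //; exact: word_map_mem_attractor.
by rewrite eq_st; exists (word_map w t a) => //; exact: word_map_mem_attractor.
Qed.

(** The orbit of a single point [x] of [non_overlap w] is already dense: the
    word that reaches [a] from a point [b] of the attractor also carries [x]
    close to [a], uniformly in [b] because the attractor is bounded. *)
Lemma attractor_sub_closure_non_overlap w :
  (forall i, contracting (w i)) -> non_overlap w !=set0 ->
  attractor w `<=` closure (non_overlap w).
Proof.
move=> wc [x Dx]; have Ax := non_overlap_attractor Dx.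
have wA : is_attractor w (attractor w).
  by apply: attractor_is_attractor; exists x.
have [q /andP[q0 q1] wq] := contracting_common_ratio wc.
have [_ cA _] := wA; have [M AM] := compact_mdist_bounded x cA.
move=> a Aa B /nbhs_ballP[e /= e0 aB].
have [n qnM] : exists n, q ^+ n * M < e.
  have : (fun n => q ^+ n * M) @ \oo --> 0 * M.
    by apply: cvgMl; apply: cvg_expr; rewrite ger0_norm.
  rewrite mul0r => /cvgrPdist_lt/(_ _ e0)[n _ /(_ n (leqnn n)) /= nM].
  by exists n; rewrite (le_lt_trans (ler_norm _)) // -normrN -sub0r.
have [s sn [b Ab aE]] := attractor_word_map n wA Aa.
exists (word_map w s x); split; first exact: word_map_non_overlap.
apply: aB; rewrite ballEmdist /= aE.
rewrite (le_lt_trans (word_map_lipschitz _ _ _ q0 wq)) // sn.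
by rewrite (le_lt_trans _ qnM) // ler_wpM2l ?exprn_ge0 // metric_sym AM.
Qed.

End iterated_function_system.

Theorem proposition2 (R : realType) (X : completeMetricType R)
    (N : nat) (N_gt0 : (0 < N)%N) (w : 'I_N -> X -> X)
    (w_contr : forall i, contracting_homeomorphisms (w i))
    (D_neq0 : non_overlap w !=set0) :
  [/\ forall i, w i @` non_overlap w `<=` non_overlap w,
      forall i j, i != j -> w i @` non_overlap w `&` w j @` non_overlap w = set0,
      closure (non_overlap w) = attractor w &
      (\bigcap_(n in [set n | (0 < n)%N]) irredundant X N n) w].
Proof.
have wA : is_attractor w (attractor w).
  apply: attractor_is_attractor; case: D_neq0 => x /non_overlap_attractor Ax.
  by exists x.
have winj i : injective (w i).
  by have [_ [_ [g [wK _ _]]]] := w_contr i; exact: can_inj wK.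
split=> [i _ [x Dx <-]|i j ij||n _].
- exact: map_non_overlap.
- apply/seteqP; split=> // _ [[x Dx <-] [y /non_overlap_attractor Ay wyx]].
  have /eqP := @word_map_separates _ _ _ w [:: i] [:: j] x y wA winj Dx Ay
    erefl (esym wyx).
  by rewrite eqseq_cons (negbTE ij).
- apply/seteqP; split; last first.
    by apply: attractor_sub_closure_non_overlap => // i; case: (w_contr i).
  have [_ cA _] := wA.
  have /closure_id -> := compact_closed (@metric_hausdorff _ X) cA.
  exact/closure_subset/non_overlap_attractor.
- split=> // s sub_s; have [x Dx] := D_neq0.
  have [|t ts [a Aa]] := sub_s (word_map w s x).
    by exists x => //; exact: non_overlap_attractor.
  move/esym/(word_map_separates wA winj Dx Aa) => st.
  by move/eqP: ts; apply; apply/val_inj; rewrite /= st ?size_tuple.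
Qed.
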